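(* Let $G$ be a simple graph on vertex set $[n]$ that is semi-symmetrized $e$-positive, and let $m\ge1$. Then the concatenation $G\cdot TL_m$ is semi-symmetrized $e$-positive.
   Context: $TL_m$ is the graph on $[m]$ with an edge between $i,j$ exactly when $1\le|i-j|\le2$. For graphs $G$ on $[n]$ and $H$ on $[m]$, the concatenation $G\cdot H$ is the graph on $[n+m-1]$ whose edges are the edges of $G$ together with the edges of $H$ with both endpoints shifted by $n-1$ (so vertex $n$ of $G$ is identified with vertex $1$ of $H$). For a simple graph $G$ on $[n]$, $Y_G=\sum_\kappa x_{\kappa(1)}\cdots x_{\kappa(n)}$ in non-commuting variables $x_1,x_2,\dots$, summed over proper colorings $\kappa:[n]\to\{1,2,\dots\}$. For $\pi\vdash[n]$, $e_\pi=\sum x_{i_1}\cdots x_{i_n}$ over tuples with $i_j\ne i_k$ whenever $j\ne k$ are in a common block. For $\pi,\sigma\vdash[n]$, $\pi\sim\sigma$ if they have the same multiset of block sizes and the blocks containing $n$ have equal size; $f\equiv_n g$ means that for each $\sim$-class the sums of $e$-coefficients of $f$ and $g$ over the class agree. A graph $G$ on $[n]$ is semi-symmetrized $e$-positive if $Y_G\equiv_n g$ for some nonnegative linear combination $g$ of the $e_\pi$, $\pi\vdash[n]$. *)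

(* Defs.v *)
From HB Require Import structures.
From mathcomp Require Import all_boot all_order all_algebra.
Set Implicit Arguments. Unset Strict Implicit. Unset Printing Implicit Defensive.
Import Order.TTheory GRing.Theory Num.Theory.
Local Open Scope ring_scope.

(* Vertex set [n] is modelled as 'I_n (vertex k+1 of the paper is k here).
   A graph is a relation on 'I_n (simplicity imposed by hypotheses). *)

Definition ord_rel (n : nat) (e : rel 'I_n) : rel nat :=
  fun i j => match @insub _ (fun k => k < n)%N 'I_n i, @insub _ (fun k => k < n)%N 'I_n j with
             | Some i', Some j' => e i' j'
             | _, _ => false
             end.

Definition TL (m : nat) : rel 'I_m :=
  fun i j => [&& i != j, (i <= j + 2)%N & (j <= i + 2)%N].

(* concatenation G . H on (n + m - 1) vertices: vertex n of G (index n-1)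
   is identified with vertex 1 of H (index 0); H is shifted by n - 1. *)
Definition concat (n m : nat) (g : rel 'I_n) (h : rel 'I_m) : rel 'I_(n + m - 1) :=
  fun i j => ord_rel g i j ||
    [&& (n.-1 <= i)%N, (n.-1 <= j)%N & ord_rel h (i - n.-1)%N (j - n.-1)%N].

Definition setpart (n : nat) (P : {set {set 'I_n}}) : bool := partition P [set: 'I_n].

(* words x_{w 0} ... x_{w (n-1)} are functions 'I_n -> nat (colours/variables
   indexed by nat); a noncommutative power series is determined by its
   coefficient on each word. *)

Definition Ycoef (n : nat) (g : rel 'I_n) (w : 'I_n -> nat) : rat :=
  if [forall i, forall j, g i j ==> (w i != w j)] then 1 else 0.

Definition ecoef (n : nat) (P : {set {set 'I_n}}) (w : 'I_n -> nat) : rat :=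
  if [forall i, forall j,
        ((i != j) && [exists B in P, (i \in B) && (j \in B)]) ==> (w i != w j)]
  then 1 else 0.

Definition lastsize (n : nat) (P : {set {set 'I_n}}) : nat :=
  (\sum_(B in P | [exists x in B, val x == n.-1]) #|B|)%N.

Definition simpart (n : nat) (P Q : {set {set 'I_n}}) : bool :=
  perm_eq [seq #|B| | B : {set 'I_n} <- enum P] [seq #|B| | B : {set 'I_n} <- enum Q]
  && (lastsize P == lastsize Q).

(* f == g  where f, g are given by e-coefficient functions c, d *)
Definition equiv_n (n : nat) (c d : {set {set 'I_n}} -> rat) : Prop :=
  forall P, setpart P ->
    \sum_(Q | setpart Q && simpart P Q) c Q = \sum_(Q | setpart Q && simpart P Q) d Q.

Definition is_e_expansion (n : nat) (g : rel 'I_n) (c : {set {set 'I_n}} -> rat) : Prop :=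
  forall w : 'I_n -> nat, Ycoef g w = \sum_(P | setpart P) c P * ecoef P w.

Definition semi_sym_e_positive (n : nat) (g : rel 'I_n) : Prop :=
  exists c d : {set {set 'I_n}} -> rat,
    [/\ is_e_expansion g c,
        (forall P, setpart P -> 0 <= d P) &
        equiv_n c d].

(* Main.v *)
(** Averaging [Y_G] over the permutations of the first [n-1] positions leaves the
    pointed function [F_G(z)], the generating function of the proper colourings
    whose last vertex has colour [z]; for [e_P] it is a product of factors
    [|B|! e_|B|] over the blocks [B] not containing [n], times
    [(b-1)! q_b(z)], where [b] is the size of the last block and [q_b(z)] is the
    part of [e_b] divisible by [x_z]. So it only depends on the class of [P], and
    semi-symmetrized [e]-positivity of [G] means that [F_G] is a nonnegative
    combination of such products.

    To add the vertices of the ladder one at a time, one also keeps the colour [y]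
    of the vertex before the last. With [ehat_k], [qhat_k] the versions of
    [e_k], [q_k] rescaled by [k!], [(k-1)!] and [eps_k] the polynomial [ehat_k]
    without the variables [x_y, x_z], the two-vertex functions
      [h_(s,t) = qhat_s(y) qhat_t(z)
         - x_y x_z^2 ((s-1) eps_(s-2) eps_(t-1) - (t-1) eps_(s-1) eps_(t-2)) / (t-s)],
      [g_t = x_y x_z eps_(t-1)]
    sum over [y] to [ehat_s qhat_t(z)] and [qhat_(t+1)(z)], and adding a vertex
    adjacent to the last two maps
      [h_(s,t)] to [(s-1)(t-1)/(st) ehat_s h_(t,1) + (t-s-1)/(s(t-s)) h_(t,s+1)
                    + (t-s+1)/(t(t-s)) ehat_s g_t],
      [g_(t-1)] to [(t-2)/t h_(t,1) + 2/t g_t].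
    These coefficients, which are transition probabilities of the kind found in
    Hikita's proof of the Stanley-Stembridge conjecture, are nonnegative. *)

Require Import Defs.
From HB Require Import structures.
From mathcomp Require Import all_boot all_order all_algebra all_fingroup.
From mathcomp Require Import zify ring lra.

Set Implicit Arguments.
Unset Strict Implicit.
Unset Printing Implicit Defensive.

Import Order.TTheory GRing.Theory Num.Theory.

(** * Injective words and elementary symmetric functions *)

Section InjectiveWords.
Local Open Scope ring_scope.
Variables (R : realFieldType) (C : finType) (x : C -> R).

(* [inje k A] is [k`!] times the elementary symmetric function [e_k] in the
   variables [x c], [c \in A]: the sum over injective words of length [k]. *)
Fixpoint inje (k : nat) (A : {set C}) : R :=
  if k is k'.+1 then \sum_(c in A) x c * inje k' (A :\ c) else 1.
Arguments inje : simpl never.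

Lemma inje0 A : inje 0 A = 1.
Proof. by []. Qed.

Lemma injeS k (A : {set C}) :
  inje k.+1 A = \sum_(c in A) x c * inje k (A :\ c).
Proof. by []. Qed.

(** An injective word either avoids [z] or carries it in exactly one of its [k] positions. *)
Lemma inje_rem k (A : {set C}) z : z \in A ->
  inje k A = inje k (A :\ z) + k%:R * x z * inje k.-1 (A :\ z).
Proof.
elim: k A => [|k IHk] A zA; first by rewrite !inje0 !mul0r addr0.
rewrite injeS (bigD1 z) //=.
have -> : \sum_(c in A | c != z) x c * inje k (A :\ c) =
   \sum_(c in A :\ z) (x c * inje k (A :\ z :\ c)
     + k%:R * x z * (x c * inje k.-1 (A :\ z :\ c))).
  apply: eq_big => [c|c /andP[cA cz]]; first by rewrite !inE andbC.
  rewrite (IHk (A :\ c)) ?inE ?zA ?(eq_sym z) ?cz //.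
  by rewrite !setDDl [[set c] :|: _]setUC; ring.
rewrite big_split -mulr_sumr /=.
case: k {IHk} => [|k] /=; first by rewrite injeS; ring.
by rewrite [inje k.+2 _]injeS [inje k.+1 (A :\ z)]injeS -natr1; ring.
Qed.

Lemma inje_sum_rem k (A : {set C}) :
  \sum_(c in A) inje k (A :\ c) = (#|A|%:R - k%:R) * inje k A.
Proof.
have -> : \sum_(c in A) inje k (A :\ c) =
   \sum_(c in A) (inje k A - k%:R * (x c * inje k.-1 (A :\ c))).
  by apply: eq_bigr => c cA; rewrite (inje_rem k cA); ring.
rewrite sumrB sumr_const -mulr_sumr -mulr_natl.
by case: k => [|k] /=; rewrite ?injeS; ring.
Qed.

End InjectiveWords.
Arguments inje : simpl never.

(** * The two-vertex transfer operator *)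

Section Transfer.
Local Open Scope ring_scope.
Variables (R : realFieldType) (C : finType) (x : C -> R).

Local Notation e k := (inje x k [set: C]).
Local Notation e2 k y z := (inje x k ([set: C] :\ y :\ z)).

(* [k`!] times the part of [e_k.+1] divisible by [x z]. *)
Definition rooted (k : nat) (z : C) : R := x z * inje x k ([set: C] :\ z).

(* [pair2 s t] and [edge2 t] are the functions [h_(s+1,t+1)] and [g_(t+1)] of the
   introduction. At [s = t] the division by [0] makes [pair2] meaningless, and at
   [t = s.+1] it is never used: [edge2] takes its place. *)
Definition pair2 (s t : nat) (p : C * C) : R :=
  let: (y, z) := p in
  (y != z)%:R * (rooted s y * rooted t z
   - x z * (x y * x z * (s%:R * e2 s.-1 y z * e2 t y z
                         - t%:R * e2 s y z * e2 t.-1 y z)) / (t%:R - s%:R)).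

Definition edge2 (t : nat) (p : C * C) : R :=
  let: (y, z) := p in (y != z)%:R * (x y * x z * e2 t y z).

Definition addfst (f : C -> R) (p : C * C) : R :=
  let: (y, z) := p in (y != z)%:R * (f y * x z).

Definition forget (f : C * C -> R) (z : C) : R := \sum_y f (y, z).

(* The effect on two-vertex functions of adding a vertex adjacent to the last two. *)
Definition addTL (f : C * C -> R) (p : C * C) : R :=
  let: (z, w) := p in (z != w)%:R * (x w * (forget f z - f (w, z))).

Lemma e2C k y z : e2 k y z = e2 k z y.
Proof. by rewrite !setDDl [[set y] :|: _]setUC. Qed.

Lemma e1E k y z : y != z ->
  inje x k ([set: C] :\ y) = e2 k y z + k%:R * x z * e2 k.-1 y z.
Proof. by move=> yz; apply: inje_rem; rewrite !inE eq_sym yz. Qed.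

Lemma rootedE k y z : y != z ->
  rooted k y = x y * (e2 k y z + k%:R * x z * e2 k.-1 y z).
Proof. by move=> yz; rewrite /rooted (e1E _ yz). Qed.

Lemma rooted_sum k : \sum_z rooted k z = e k.+1.
Proof. by rewrite injeS; apply: eq_bigl => z; rewrite inE. Qed.

Lemma big_neq (z : C) (f : C -> R) :
  \sum_y (y != z)%:R * f y = \sum_(y in [set: C] :\ z) f y.
Proof.
rewrite [RHS]big_mkcond; apply: eq_bigr => y _.
by rewrite !inE andbT; case: eqP; rewrite ?mul0r ?mul1r.
Qed.

Lemma forget_edge2 t z : forget (edge2 t) z = rooted t.+1 z.
Proof.
rewrite /forget /edge2 (big_neq z (fun y => x y * x z * e2 t y z)) /rooted injeS.
rewrite [RHS]mulr_sumr; apply: eq_bigr => y _.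
by rewrite e2C; ring.
Qed.

(** The product in [pair2] misses the term [rooted s z * rooted t z], because [y = z] is excluded.
    By [inje_sum_rem] the correction sums to [(s - t) / (t - s)] times that term, so subtracting it
    restores the term. *)
Lemma forget_pair2 s t z : s != t -> forget (pair2 s t) z = e s.+1 * rooted t z.
Proof.
move=> st.
have d0 : t%:R - s%:R != 0 :> R by rewrite subr_eq0 eqr_nat eq_sym.
rewrite /forget /pair2 (big_neq z (fun y => rooted s y * rooted t z - x z *
  (x y * x z * (s%:R * e2 s.-1 y z * e2 t y z - t%:R * e2 s y z * e2 t.-1 y z)) /
     (t%:R - s%:R))).
set B := [set: C] :\ z.
have -> : e s.+1 = (\sum_(y in B) rooted s y) + rooted s z.
  rewrite -rooted_sum (bigD1 z) //= addrC; congr (_ + _).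
  by apply: eq_bigl => y; rewrite !inE andbT.
rewrite sumrB -mulr_suml mulrDl; congr (_ + _).
have -> : \sum_(y in B) x z * (x y * x z * (s%:R * e2 s.-1 y z * e2 t y z
      - t%:R * e2 s y z * e2 t.-1 y z)) / (t%:R - s%:R)
  = x z * x z / (t%:R - s%:R) * (inje x s B * (\sum_(y in B) inje x t (B :\ y))
       - inje x t B * (\sum_(y in B) inje x s (B :\ y))).
  rewrite mulrBr !mulr_sumr -sumrB; apply: eq_bigr => y yB.
  rewrite (inje_rem x s yB) (inje_rem x t yB) !(e2C _ y z) -/B.
  by ring.
rewrite !inje_sum_rem /rooted -/B.
by field.
Qed.

Lemma addTL_edge2 t p : addTL (edge2 t) p =
  t%:R / t.+2%:R * pair2 t.+1 0 p + 2%:R / t.+2%:R * edge2 t.+1 p.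
Proof.
case: p => z w; rewrite /addTL /= forget_edge2.
have [->|zw] := eqVneq z w; first by rewrite !mul0r !mulr0 addr0.
rewrite /= !mul1r (rootedE _ zw).
have wz : w != z by rewrite eq_sym.
rewrite (rootedE 0 wz) /= (e2C _ w z) !inje0.
have -> : t.+2%:R = t%:R + 2%:R :> R by rewrite -natrD addn2.
have -> : t.+1%:R = t%:R + 1 :> R by rewrite -natr1.
field.
by rewrite !natr1 -?natrD !pnatr_eq0 addn2.
Qed.

Lemma addfst_rooted t p : addfst (rooted t) p =
  t%:R / t.+1%:R * pair2 t 0 p + t.+1%:R^-1 * edge2 t p.
Proof.
case: p => y z; rewrite /=.
have [->|yz] := eqVneq y z; first by rewrite !mul0r !mulr0 addr0.
have zy : z != y by rewrite eq_sym.
rewrite !mul1r (rootedE t yz) (rootedE 0 zy) /= !inje0.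
case: t => [|t]; first by rewrite inje0 invr1 !mul0r !mul1r; ring.
have -> : t.+2%:R = t%:R + 2%:R :> R by rewrite -natrD addn2.
have -> : t.+1%:R = t%:R + 1 :> R by rewrite -natr1.
field.
by rewrite !natr1 -?natrD !pnatr_eq0 addn2.
Qed.

(* The three coefficients are the residues of
   [(X - s) (X - t) / (X (X - s - 1) (X - t - 1))]. *)
Lemma addTL_pair2 s t p : s != t -> t != s.+1 ->
  addTL (pair2 s t) p =
    s%:R * t%:R / (s.+1%:R * t.+1%:R) * (e s.+1 * pair2 t 0 p)
  + (t%:R - s.+1%:R) / (s.+1%:R * (t%:R - s%:R)) * pair2 t s.+1 p
  + (t.+1%:R - s%:R) / (t.+1%:R * (t%:R - s%:R)) * (e s.+1 * edge2 t p).
Proof.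
move=> st ts; case: p => z w; rewrite /addTL forget_pair2 // /=.
have [->|zw] := eqVneq z w; first by rewrite !mul0r !mulr0 !addr0.
have wz : w != z by rewrite eq_sym.
rewrite !mul1r.
rewrite (inje_rem x s.+1 (in_setT z)) (e1E s.+1 zw) (e1E s zw) /=.
rewrite (rootedE t zw) (rootedE s wz) (rootedE s.+1 wz) (rootedE 0 wz) /= !inje0.
rewrite !(e2C _ w z).
have h0 : t%:R - s%:R != 0 :> R by rewrite subr_eq0 eqr_nat eq_sym.
have h1 : t%:R - (s%:R + 1) != 0 :> R by rewrite natr1 subr_eq0 eqr_nat.
have h2 : s%:R + 1 != 0 :> R by rewrite natr1 pnatr_eq0.
have h3 : t%:R + 1 != 0 :> R by rewrite natr1 pnatr_eq0.
have h4 : s%:R + 1 - t%:R != 0 :> R by rewrite -oppr_eq0 opprB.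
rewrite -![_.+1%:R]natr1.
(* [pair2 t 0] divides by [- t], so [t = 0] is treated apart; its coefficient vanishes there. *)
have [t0|t0] := eqVneq (t%:R : R) 0.
  have {}h0 : (s%:R : R) != 0 by rewrite t0 sub0r oppr_eq0 in h0.
  rewrite t0 !(mul0r, mulr0, add0r, sub0r, subr0, addr0).
  by field; rewrite h0 h2.
move: (t%:R) (s%:R) h0 h1 h2 h3 h4 t0 => a b h0 h1 h2 h3 h4 t0.
by field; rewrite t0 h0 h2 h3 h4.
Qed.

End Transfer.

(** * Cones of pointed symmetric functions *)

Section Cones.
Local Open Scope ring_scope.
Variables (R : realFieldType) (C : finType).

(** Members are families over all [x], so that one combination serves every specialisation; the
    index is the degree. [cone_ext] stands in for functional extensionality. *)
Inductive cone (I : Type) (gen : nat -> ((C -> R) -> I -> R) -> Prop) :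
    nat -> ((C -> R) -> I -> R) -> Prop :=
| cone0 k : cone gen k (fun _ _ => 0)
| coneD k f g : cone gen k f -> cone gen k g ->
    cone gen k (fun x i => f x i + g x i)
| coneZ k a f : 0 <= a -> cone gen k f -> cone gen k (fun x i => a * f x i)
| coneE k j f : (0 < j)%N -> cone gen k f ->
    cone gen (k + j)%N (fun x i => inje x j [set: C] * f x i)
| cone_gen k f : gen k f -> cone gen k f
| cone_ext k f g : (forall x i, f x i = g x i) -> cone gen k f -> cone gen k g.

Inductive gen1 : nat -> ((C -> R) -> C -> R) -> Prop :=
| Gen1 t : gen1 t.+1 (fun x => rooted x t).

Inductive gen2 : nat -> ((C -> R) -> C * C -> R) -> Prop :=
| GenPair s t : s != t -> t != s.+1 -> gen2 (s.+1 + t.+1)%N (fun x => pair2 x s t)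
| GenEdge t : gen2 t.+2 (fun x => edge2 x t).

(** At fixed [x] the factor in [coneE] is a scalar, so a linear operator commutes with it and only
    the generators need checking. *)
Lemma cone_map I J (gen : nat -> ((C -> R) -> I -> R) -> Prop)
    (gen' : nat -> ((C -> R) -> J -> R) -> Prop)
    (L : (C -> R) -> (I -> R) -> J -> R) d :
  (forall x f g j, (forall i, f i = g i) -> L x f j = L x g j) ->
  (forall x f g j, L x (fun i => f i + g i) j = L x f j + L x g j) ->
  (forall x a f j, L x (fun i => a * f i) j = a * L x f j) ->
  (forall k f, gen k f -> cone gen' (k + d)%N (fun x => L x (f x))) ->
  forall k f, cone gen k f -> cone gen' (k + d)%N (fun x => L x (f x)).
Proof.
move=> Lext LD LZ Lgen k f; elim=> {k f}.
- move=> k; apply: cone_ext (cone0 _ _) => x j.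
  rewrite -[LHS](mul0r (L x (fun=> 0) j)) -LZ.
  by apply: Lext => i; rewrite mul0r.
- move=> k f g _ cf _ cg; apply: cone_ext (coneD cf cg) => x j.
  by rewrite LD.
- move=> k a f a0 _ cf; apply: cone_ext (coneZ a0 cf) => x j.
  by rewrite LZ.
- move=> k j f j0 _ cf; rewrite addnAC.
  by apply: cone_ext (coneE j0 cf) => x i; rewrite LZ.
- exact: Lgen.
- move=> k f g fg _ cf; apply: cone_ext cf => x j.
  exact/Lext/fg.
Qed.

Lemma cone_sum I gen k (T : Type) (r : seq T) (P : pred T)
    (F : T -> (C -> R) -> I -> R) :
  (forall t, P t -> cone gen k (F t)) ->
  cone gen k (fun x i => \sum_(t <- r | P t) F t x i).
Proof.
move=> cF; elim: r => [|t r IHr].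
  by apply: cone_ext (cone0 gen k) => x i; rewrite big_nil.
have [Pt|nPt] := boolP (P t); last first.
  by apply: cone_ext IHr => x i; rewrite big_cons (negPf nPt).
by apply: cone_ext (coneD (cF t Pt) IHr) => x i; rewrite big_cons Pt.
Qed.

Lemma cone_prod I (gen : nat -> ((C -> R) -> I -> R) -> Prop) k f (r : seq nat) :
  all (leq 1) r -> cone gen k f ->
  cone gen (k + sumn r)%N (fun x i => (\prod_(j <- r) inje x j [set: C]) * f x i).
Proof.
elim: r => [|j r IHr] /= r0 cf.
  by rewrite addn0; apply: cone_ext cf => x i; rewrite big_nil mul1r.
have [j0 {}r0] := andP r0; rewrite (addnC j) addnA.
apply: cone_ext (coneE j0 (IHr r0 cf)) => x i.
by rewrite big_cons mulrA.
Qed.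

Lemma cone_forget k f :
  cone gen2 k f -> cone gen1 k (fun x => forget (f x)).
Proof.
move=> cf; rewrite -[k]addn0.
apply: (cone_map (L := fun=> @forget R C) (gen := gen2)) cf => {k f}.
- by move=> x f g z fg; apply: eq_bigr.
- by move=> x f g z; rewrite /forget big_split.
- by move=> x a f z; rewrite /forget mulr_sumr.
move=> k f [s t st ts|t]; rewrite addn0.
  rewrite addnC.
  have c1 : cone gen1 t.+1 (fun x => rooted x t) by exact/cone_gen/Gen1.
  by apply: cone_ext (coneE (ltn0Sn s) c1) => x z; rewrite forget_pair2.
have c1 : cone gen1 t.+2 (fun x => rooted x t.+1) by exact/cone_gen/Gen1.
by apply: cone_ext c1 => x z; rewrite forget_edge2.
Qed.

(** The factor [t] absorbs the case [t = 0], where [pair2 0 0] is not a generator. *)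
Lemma cone_pair0 t :
  cone gen2 t.+2 (fun x p => t%:R * pair2 x t 0 p).
Proof.
case: t => [|t]; first by apply: cone_ext (cone0 _ _) => x p; rewrite mul0r.
by apply: coneZ; rewrite ?ler0n // -addn1; apply/cone_gen/GenPair.
Qed.

Lemma cone_edge t : cone gen2 t.+2 (fun x => edge2 x t).
Proof. exact/cone_gen/GenEdge. Qed.

Lemma cone_addfst k f :
  cone gen1 k f -> cone gen2 k.+1 (fun x => addfst x (f x)).
Proof.
rewrite -addn1; apply: cone_map => {k f}.
- by move=> x f g [y z] fg; rewrite /addfst fg.
- by move=> x f g [y z]; rewrite /addfst; ring.
- by move=> x a f [y z]; rewrite /addfst; ring.
move=> _ _ [t]; rewrite addn1.
have t0 : 0 <= t.+1%:R^-1 :> R by rewrite invr_ge0 ler0n.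
apply: cone_ext (coneD (coneZ t0 (cone_pair0 t)) (coneZ t0 (cone_edge t))) => x p.
by rewrite addfst_rooted; ring.
Qed.

Lemma cone_addTL k f : cone gen2 k f -> cone gen2 k.+1 (fun x => addTL x (f x)).
Proof.
rewrite -addn1; apply: cone_map => {k f}.
- move=> x f g [y z] fg; rewrite /addTL /forget fg.
  by under eq_bigr do rewrite fg.
- by move=> x f g [y z]; rewrite /addTL /forget big_split /=; ring.
- by move=> x a f [y z]; rewrite /addTL /forget -mulr_sumr; ring.
move=> _ _ [s t st ts|t]; rewrite addn1; last first.
  (* [cone_pair0 t.+1] already carries the factor [t.+1], which is divided out here. *)
  have t0 : 0 <= t.+2%:R^-1 * t.+1%:R^-1 * t%:R :> R.
    by rewrite !mulr_ge0 ?invr_ge0 ?ler0n.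
  have t1 : 0 <= 2%:R / t.+2%:R :> R by rewrite divr_ge0 ?ler0n.
  apply: cone_ext (coneD (coneZ t0 (cone_pair0 t.+1))
                         (coneZ t1 (cone_edge t.+1))) => x p.
  rewrite addTL_edge2; have ? : t.+1%:R != 0 :> R by rewrite pnatr_eq0.
  by field; rewrite nat1r -(natrD _ 2) !pnatr_eq0.
(* Signs agree in the two quotients: [s < t] means [s.+1 <= t], and [t < s] means [t.+1 <= s]. *)
have cpos a b : s != t -> (s < t -> b <= a)%N -> (t < s -> a <= b)%N ->
    0 <= (a%:R - b%:R) / (t%:R - s%:R) :> R.
  move=> + ab ba; case: ltngtP => // [lt_st|lt_ts] _.
    by rewrite divr_ge0 // subr_ge0 ler_nat ?ab // ltnW.
  rewrite -mulrNN -invrN !opprB.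
  by rewrite divr_ge0 // subr_ge0 ler_nat ?ba // ltnW.
have p0 : 0 <= s%:R / (s.+1%:R * t.+1%:R) :> R.
  by rewrite divr_ge0 ?mulr_ge0 ?ler0n.
have p1 : 0 <= s.+1%:R^-1 * ((t%:R - s.+1%:R) / (t%:R - s%:R)) :> R.
  by rewrite mulr_ge0 ?invr_ge0 ?ler0n ?cpos // => h; lia.
have p2 : 0 <= t.+1%:R^-1 * ((t.+1%:R - s%:R) / (t%:R - s%:R)) :> R.
  by rewrite mulr_ge0 ?invr_ge0 ?ler0n ?cpos // => h; lia.
have c0 := coneZ p0 (coneE (ltn0Sn s) (cone_pair0 t)).
have c2 := coneZ p2 (coneE (ltn0Sn s) (cone_edge t)).
have ts' : t != s by rewrite eq_sym.
(* The indices [(t, s.+1)] are again admissible: [t != s.+1] is assumed, and [s.+1 != t.+1] follows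
   from [s != t]. *)
have c1 : cone gen2 (t.+1 + s.+2)%N
   (fun x p => s.+1%:R^-1 * ((t%:R - s.+1%:R) / (t%:R - s%:R)) * pair2 x t s.+1 p).
  by apply: coneZ => //; apply/cone_gen/GenPair.
have E1 : (t.+1 + s.+2 = (s.+1 + t.+1).+1)%N by lia.
have E2 : (t.+2 + s.+1 = (s.+1 + t.+1).+1)%N by lia.
rewrite {}E1 in c1; rewrite {}E2 in c0 c2.
apply: cone_ext (coneD (coneD c0 c1) c2) => x p.
rewrite addTL_pair2 //.
by field; rewrite !nat1r !pnatr_eq0 subr_eq0 eqr_nat ts'.
Qed.

End Cones.

(** * Sums over words *)

Section Words.
Local Open Scope ring_scope.
Variables (R : realFieldType) (C : finType) (c0 : C).

Definition upd (w : nat -> C) (k : nat) (c : C) : nat -> C :=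
  fun i => if i == k then c else w i.

Lemma upd_eq w k c : upd w k c k = c.
Proof. by rewrite /upd eqxx. Qed.

Lemma upd_lt w k c i : (i < k)%N -> upd w k c i = w i.
Proof. by rewrite /upd; case: ltngtP. Qed.

(** The recursion peels off the last letter, to match the addition of a last vertex; positions from
    [k] on hold the dummy letter [c0]. *)
Fixpoint wsum (k : nat) (f : (nat -> C) -> R) : R :=
  if k is k'.+1 then \sum_c wsum k' (fun w => f (upd w k' c))
  else f (fun _ => c0).

Lemma eq_wsum k f g : (forall w, f w = g w) -> wsum k f = wsum k g.
Proof.
elim: k f g => [|k IHk] f g fg /=; first exact: fg.
by apply: eq_bigr => c _; apply: IHk => w.
Qed.

Lemma wsumZ k a f : wsum k (fun w => a * f w) = a * wsum k f.
Proof.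
elim: k f => [|k IHk] f //=.
by rewrite mulr_sumr; apply: eq_bigr => c _; rewrite IHk.
Qed.

Lemma wsum_sum k (I : Type) (r : seq I) (P : pred I) (F : I -> (nat -> C) -> R) :
  wsum k (fun w => \sum_(i <- r | P i) F i w) = \sum_(i <- r | P i) wsum k (F i).
Proof.
elim: k F => [|k IHk] F //=.
rewrite exchange_big /=; apply: eq_bigr => c _.
exact: (IHk (fun i w => F i (upd w k c))).
Qed.

Lemma wsumD k f g :
  wsum k (fun w => f w + g w) = wsum k f + wsum k g.
Proof.
elim: k f g => [|k IHk] f g //=.
by rewrite -big_split; apply: eq_bigr => c _; rewrite IHk.
Qed.

Lemma wsumS k f : wsum k.+1 f = \sum_c wsum k (fun w => f (upd w k c)).
Proof. by []. Qed.

Definition word k (w : {ffun 'I_k -> C}) : nat -> C :=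
  fun i => if insub i is Some j then w j else c0.

Lemma wordE k (w : {ffun 'I_k -> C}) (i : 'I_k) : word w i = w i.
Proof. by rewrite /word valK. Qed.

Lemma wsum_ffun k f :
  (forall u v : nat -> C, (forall i, (i < k)%N -> u i = v i) -> f u = f v) ->
  wsum k f = \sum_(w : {ffun 'I_k -> C}) f (word w).
Proof.
elim: k f => [|k IHk] f fE /=.
  have w0 (w : {ffun 'I_0 -> C}) : w = [ffun=> c0] by apply/ffunP=> -[].
  by rewrite (bigD1 [ffun=> c0]) //= big1 ?addr0 => [|w]; [exact: fE|rewrite (w0 w) eqxx].
pose ext (p : C * {ffun 'I_k -> C}) : {ffun 'I_k.+1 -> C} :=
  [ffun i => if unlift ord_max i is Some j then p.2 j else p.1].
pose res (w : {ffun 'I_k.+1 -> C}) : C * {ffun 'I_k -> C} :=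
  (w ord_max, [ffun j => w (lift ord_max j)]).
rewrite (reindex ext) /=; last first.
  exists res => [[c w] _|w _]; rewrite /ext /res ?ffunE ?unlift_none.
    congr (_, _); apply/ffunP => j; by rewrite !ffunE liftK.
  apply/ffunP => i; rewrite !ffunE.
  by case: unliftP => [j ->|->] //; rewrite ffunE.
rewrite -(pair_bigA _ (fun c w => f (word (ext (c, w))))) /=.
apply: eq_bigr => c _; rewrite IHk.
  apply: eq_bigr => w _; apply: fE => i; rewrite ltnS => ik.
  rewrite -[i]/(val (Ordinal (ik : (i < k.+1)%N))) wordE ffunE /=.
  case: unliftP => [j|] /(congr1 val) /= ->; last by rewrite upd_eq.
  by rewrite [bump k j](lift_max j) upd_lt // wordE.
move=> u v uv; apply: fE => i; rewrite ltnS leq_eqVlt => /orP[/eqP->|ik].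
  by rewrite !upd_eq.
by rewrite !upd_lt // uv.
Qed.

End Words.
Arguments wsum : simpl never.

(** * Pointed chromatic functions and triangular ladders *)

Section Chromatic.
Local Open Scope ring_scope.
Variables (R : realFieldType) (C : finType) (c0 : C) (E : rel nat).

Definition monom (x : C -> R) (k : nat) (w : nat -> C) : R :=
  \prod_(i < k) x (w i).

Definition proper_word (k : nat) (w : nat -> C) : bool :=
  [forall i : 'I_k, forall j : 'I_k, E i j ==> (w i != w j)].

(** This is [F_G(z)] for the graph on the first [k] vertices; as [E] lives on [nat], all these
    graphs share one relation. *)
Definition chrom1 k (x : C -> R) (z : C) : R :=
  wsum c0 k (fun w => (proper_word k w && (w k.-1 == z))%:R * monom x k w).

Definition chrom2 k (x : C -> R) (p : C * C) : R :=
  wsum c0 k (fun w =>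
    [&& proper_word k w, w k.-2 == p.1 & w k.-1 == p.2]%:R * monom x k w).

Lemma proper_wordP k w :
  reflect (forall i j, (i < k)%N -> (j < k)%N -> E i j -> w i != w j) (proper_word k w).
Proof.
apply: (iffP forallP) => [H i j ik jk Eij|H i].
  by have /forallP/(_ (Ordinal jk))/implyP := H (Ordinal ik); apply.
by apply/forallP => j; apply/implyP; apply: H.
Qed.

Lemma monom_upd x k w c : monom x k.+1 (upd w k c) = monom x k w * x c.
Proof.
rewrite /monom big_ord_recr /= upd_eq; congr (_ * _).
by apply: eq_bigr => i _; rewrite upd_lt.
Qed.

Lemma proper_word_upd k w c : ~~ E k k ->
  proper_word k.+1 (upd w k c) =
  proper_word k w && [forall i : 'I_k, (E i k || E k i) ==> (w i != c)].
Proof.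
move=> Ekk; apply/proper_wordP/andP => [H|[/proper_wordP H1 /forallP H2] i j].
  split.
    apply/proper_wordP => i j ik jk Eij.
    by have := H i j (ltnW ik) (ltnW jk) Eij; rewrite !upd_lt.
  apply/forallP => i; apply/implyP => /orP[] Ei.
    by have := H i k (ltnW (ltn_ord i)) (ltnSn k) Ei; rewrite upd_eq upd_lt.
  have := H k i (ltnSn k) (ltnW (ltn_ord i)) Ei.
  by rewrite upd_eq upd_lt // eq_sym.
rewrite !ltnS (leq_eqVlt i) (leq_eqVlt j).
case/orP=> [/eqP->|ik]; case/orP=> [/eqP->|jk]; rewrite ?upd_eq.
- by rewrite (negPf Ekk).
- have /implyP := H2 (Ordinal jk) => /= h Ekj.
  by rewrite upd_lt // eq_sym h // Ekj orbT.
- have /implyP := H2 (Ordinal ik) => /= h Eik.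
  by rewrite upd_lt // h // Eik.
- by rewrite !upd_lt //; apply: H1.
Qed.

Lemma wsum_recr_last k (f : (nat -> C) -> R) (g : (nat -> C) -> C -> R) z :
  (forall w c, f (upd w k c) = (c == z)%:R * g w z) ->
  wsum c0 k.+1 f = wsum c0 k (fun w => g w z).
Proof.
move=> fg; rewrite wsumS (bigD1 z) //= big1 ?addr0 => [|c cz].
  by apply: eq_wsum => w; rewrite fg eqxx mul1r.
rewrite (@eq_wsum _ _ _ _ _ (fun w => 0 * g w z)) => [|w].
  by rewrite wsumZ mul0r.
by rewrite fg (negPf cz).
Qed.

Lemma forget_chrom2 k x z : forget (chrom2 k x) z = chrom1 k x z.
Proof.
rewrite /forget /chrom2 -wsum_sum; apply: eq_wsum => w.
rewrite (bigD1 (w k.-2)) //= eqxx /= big1 ?addr0 // => y yw.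
by rewrite [w _ == y]eq_sym (negPf yw) andbF mul0r.
Qed.

Lemma chrom2_addfst k x p : (0 < k)%N -> ~~ E k k ->
  (forall i, (i < k)%N -> E i k || E k i = (i == k.-1)) ->
  chrom2 k.+1 x p = addfst x (chrom1 k x) p.
Proof.
case: p => y z k0 Ekk Ek; rewrite /chrom2 /addfst /=.
pose g w c : R := (y != c)%:R * x c *
  ((proper_word k w && (w k.-1 == y))%:R * monom x k w).
rewrite (@wsum_recr_last _ _ g z) => [|w c].
  by rewrite wsumZ /chrom1; ring.
rewrite proper_word_upd // monom_upd upd_eq upd_lt ?prednK // /g.
have -> : [forall i : 'I_k, E i k || E k i ==> (w i != c)] = (w k.-1 != c).
  apply/forallP/idP => [H|wc i].
    have kk : (k.-1 < k)%N by rewrite prednK.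
    by have /implyP := H (Ordinal kk); apply; rewrite Ek /=.
  by rewrite Ek //; apply/implyP => /eqP->.
have [->|cz] := eqVneq c z; last by rewrite !andbF !mul0r.
case: (proper_word k w); rewrite ?mul0r ?mulr0 //=.
by case: (eqVneq (w k.-1) y) => [->|_]; case: (y != z); rewrite /= ?mul0r ?mulr0 //;
  rewrite ?andbF ?mul0r //; ring.
Qed.

(** [forget] counts all colourings with vertex [k.-1] of a given colour; those giving vertex [k.-2]
    the colour of the new vertex are subtracted. *)
Lemma chrom2_addTL k x p : (1 < k)%N -> ~~ E k k ->
  (forall i, (i < k)%N -> E i k || E k i = (k <= i + 2)%N) ->
  chrom2 k.+1 x p = addTL x (chrom2 k x) p.
Proof.
case: p => y z k1 Ekk Ek; rewrite /addTL forget_chrom2 /chrom1 /chrom2 /=.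
pose g w c : R := (y != c)%:R * x c *
  ((proper_word k w && (w k.-1 == y))%:R * monom x k w
   - [&& proper_word k w, w k.-2 == c & w k.-1 == y]%:R * monom x k w).
rewrite (@wsum_recr_last _ _ g z) => [|w c].
  rewrite wsumZ mulrA; congr (_ * _); rewrite -[X in _ + X]mulN1r.
  by rewrite -wsumZ -wsumD; apply: eq_wsum => w; rewrite mulN1r.
rewrite proper_word_upd // monom_upd upd_eq upd_lt ?prednK ?(ltnW k1) // /g.
have -> : [forall i : 'I_k, E i k || E k i ==> (w i != c)]
    = (w k.-1 != c) && (w k.-2 != c).
  apply/forallP/andP => [H|[w1 w2] i].
    have kk1 : (k.-1 < k)%N by lia.
    have kk2 : (k.-2 < k)%N by lia.
    by split; [have /implyP := H (Ordinal kk1)|have /implyP := H (Ordinal kk2)];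
       apply; rewrite Ek /=; lia.
  rewrite Ek //; apply/implyP => ki.
  have /orP[/eqP->//|/eqP->//] : (i == k.-1 :> nat) || (i == k.-2 :> nat).
  by have := ltn_ord i; lia.
have [->|cz] := eqVneq c z; last by rewrite !andbF !mul0r.
case: (proper_word k w); rewrite ?mul0r ?mulr0 ?subrr ?mulr0 //=.
case: (eqVneq (w k.-1) y) => [->|_]; last by rewrite !(andbF, mul0r) subrr !mulr0.
by case: (y != z); case: (w k.-2 == z); rewrite /= ?mul0r ?mulr0 //; ring.
Qed.

End Chromatic.

(** The first new vertex is adjacent only to vertex [n.-1], hence [addfst]; each later one is
    adjacent to its two predecessors, hence [addTL]. A final [forget] returns to one marked
    vertex. *)
Lemma cone_chrom1_ladder (R : realFieldType) (C : finType) (c0 : C) (E : rel nat)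
    (n k : nat) :
  (0 < n <= k)%N ->
  (forall j, (n <= j < k)%N -> ~~ E j j) ->
  (forall i j, (n <= j < k)%N -> (i < j)%N ->
     E i j || E j i = (n.-1 <= i)%N && (j <= i + 2)%N) ->
  cone (@gen1 R C) n (chrom1 c0 E n) -> cone (@gen1 R C) k (chrom1 c0 E k).
Proof.
move=> /andP[n0 nk] Ejj Eij c1.
have [<-//|nk'] := eqVneq n k.
suff H d : (n + d < k)%N -> cone (@gen2 R C) (n + d).+1 (chrom2 c0 E (n + d).+1).
  have Ek : k = (n + (k - n.+1)).+1 by lia.
  rewrite Ek; apply: cone_ext (cone_forget (H (k - n.+1)%N _)); last by lia.
  by move=> x z; rewrite forget_chrom2.
elim: d => [|d IHd] dk.
  rewrite addn0 in dk *.
  apply: cone_ext (cone_addfst c1) => x p; rewrite chrom2_addfst //.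
    by apply: Ejj; rewrite leqnn.
  by move=> i i_n; rewrite Eij ?leqnn //; lia.
rewrite addnS in dk *.
apply: cone_ext (cone_addTL (IHd (ltnW dk))) => x p; rewrite chrom2_addTL //.
- by lia.
- by apply: Ejj; lia.
- by move=> i i_n; rewrite Eij //; lia.
Qed.

(** * Set partitions *)

Section Blocks.
Local Open Scope ring_scope.
Variables (R : realFieldType) (C : finType) (c0 : C) (x : C -> R).
Variables (L : finType) (lab : nat -> L).

(* Letters are allowed in position [i] only if they lie in [av (lab i)], and
   positions with equal labels carry distinct letters. *)
Definition blockwise (av : L -> {set C}) (k : nat) (w : nat -> C) : bool :=
  [forall i : 'I_k, w i \in av (lab i)] &&
  [forall i : 'I_k, forall j : 'I_k, (i != j) && (lab i == lab j) ==> (w i != w j)].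

Definition labcount (k : nat) (l : L) : nat := (\sum_(i < k) (lab i == l))%N.

Definition updav (av : L -> {set C}) (l0 : L) (c : C) (l : L) : {set C} :=
  if l == l0 then av l :\ c else av l.

Lemma blockwiseP (av : L -> {set C}) k w :
  reflect ((forall i, (i < k)%N -> w i \in av (lab i)) /\
    (forall i j, (i < j < k)%N -> lab i = lab j -> w i != w j))
  (blockwise av k w).
Proof.
apply: (iffP andP) => -[H1 H2]; split.
- by move=> i ik; have /forallP/(_ (Ordinal ik)) := H1.
- move=> i j /andP[ij jk] lij; have ik := ltn_trans ij jk.
  have /forallP/(_ (Ordinal ik))/forallP/(_ (Ordinal jk))/implyP := H2; apply.
  by rewrite -val_eqE /= lij eqxx andbT; rewrite neq_ltn ij.
- by apply/forallP => i; apply: H1.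
- apply/forallP => i; apply/forallP => j; apply/implyP => /andP[ij /eqP lij].
  move: ij; rewrite -val_eqE neq_ltn => /orP[] h.
    by apply: H2 => //; rewrite h /=.
  by rewrite eq_sym; apply: H2 => //; rewrite h /=.
Qed.

Lemma blockwise_upd (av : L -> {set C}) k w c :
  blockwise av k.+1 (upd w k c) =
  (c \in av (lab k)) && blockwise (updav av (lab k) c) k w.
Proof.
apply/blockwiseP/andP => [[H1 H2]|[ck /blockwiseP[H1 H2]]]; split.
- by have := H1 k (ltnSn k); rewrite upd_eq.
- apply/blockwiseP; split=> [i ik|i j /andP[ij jk] lij].
    have := H1 i (ltnW ik); rewrite upd_lt // /updav => wi.
    case: eqP => // lik; rewrite !inE wi andbT.
    by have := H2 i k; rewrite ik ltnSn upd_eq upd_lt //; apply.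
  have := H2 i j; rewrite ij ltnS (ltnW jk) !upd_lt ?(ltn_trans ij jk) //.
  exact.
- move=> i; rewrite ltnS leq_eqVlt => /orP[/eqP->|ik]; first by rewrite upd_eq.
  rewrite upd_lt //; have := H1 i ik; rewrite /updav; case: eqP => // _.
  by rewrite !inE => /andP[].
- move=> i j /andP[ij]; rewrite ltnS leq_eqVlt => /orP[/eqP jk|jk] lij.
    rewrite jk in ij lij *; rewrite upd_eq upd_lt //.
    by have := H1 i ij; rewrite /updav lij eqxx !inE => /andP[].
  by rewrite !upd_lt ?(ltn_trans ij jk) //; apply: H2 => //; rewrite ij.
Qed.

Lemma labcountS k l : labcount k.+1 l = (labcount k l + (lab k == l))%N.
Proof. by rewrite /labcount big_ord_recr. Qed.

(** Fixing the last letter [c] only removes [c] from the letters allowed to its block. This is why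
    [av] is arbitrary: the induction passes to [updav], and distinct blocks give independent
    factors. *)
Lemma wsum_blockwise (av : L -> {set C}) k :
  wsum c0 k (fun w => (blockwise av k w)%:R * monom x k w) =
  \prod_l inje x (labcount k l) (av l).
Proof.
elim: k av => [|k IHk] av.
  rewrite /wsum /monom big_ord0 mulr1 big1 => [|l _]; last first.
    by rewrite /labcount big_ord0 inje0.
  have -> // : blockwise av 0 (fun _ => c0).
  by apply/blockwiseP; split=> // i j; rewrite ltn0 andbF.
rewrite wsumS (bigD1 (lab k)) //= labcountS eqxx addn1 injeS mulr_suml.
rewrite [RHS]big_mkcond; apply: eq_bigr => c _.
rewrite (@eq_wsum _ _ _ _ _ (fun w => (c \in av (lab k))%:R * x c *
  ((blockwise (updav av (lab k) c) k w)%:R * monom x k w))) => [|w].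
  rewrite wsumZ IHk; case: ifP => cl; last by rewrite !mul0r.
  rewrite mul1r -mulrA (bigD1 (lab k)) //= /updav eqxx; congr (_ * (_ * _)).
  apply: eq_bigr => l ll; rewrite (negPf ll) labcountS eq_sym (negPf ll).
  by rewrite addn0.
rewrite monom_upd blockwise_upd.
by case: (c \in _); case: (blockwise _ _ _) => /=; ring.
Qed.

Lemma wsum_blockwise_last k z :
  wsum c0 k.+1 (fun w => (blockwise (fun=> [set: C]) k.+1 w && (w k == z))%:R
                          * monom x k.+1 w) =
  rooted x (labcount k (lab k)) z *
  \prod_(l | l != lab k) inje x (labcount k.+1 l) [set: C].
Proof.
pose g w c : R := x c *
  ((blockwise (updav (fun=> [set: C]) (lab k) c) k w)%:R * monom x k w).
rewrite (@wsum_recr_last _ _ _ _ _ g z) => [|w c].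
  rewrite wsumZ wsum_blockwise (bigD1 (lab k)) //= /updav eqxx /rooted mulrA.
  congr (_ * _); apply: eq_bigr => l ll.
  by rewrite (negPf ll) labcountS eq_sym (negPf ll) addn0.
rewrite monom_upd blockwise_upd upd_eq inE /g.
have [->|_] := eqVneq c z; last by rewrite andbF !mul0r.
by case: (blockwise _ _ _) => /=; ring.
Qed.

End Blocks.

Section Partitions.
Local Open Scope ring_scope.
Variables (R : realFieldType) (C : finType) (c0 : C).

Definition blockproper (k : nat) (P : {set {set 'I_k}}) (w : nat -> C) : bool :=
  [forall i : 'I_k, forall j : 'I_k,
    ((i != j) && [exists B in P, (i \in B) && (j \in B)]) ==> (w i != w j)].

Definition echrom1 (k : nat) (P : {set {set 'I_k}}) (x : C -> R) (z : C) : R :=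
  wsum c0 k (fun w => (blockproper P w && (w k.-1 == z))%:R * monom x k w).

Lemma lastsizeE k (P : {set {set 'I_k.+1}}) :
  setpart P -> lastsize P = #|pblock P ord_max|.
Proof.
move=> pP; have tP := partition_trivIset pP.
have cov i : i \in cover P by rewrite (cover_partition pP) inE.
rewrite /lastsize (bigD1 (pblock P ord_max)) /=; last first.
  rewrite pblock_mem ?cov //=; apply/existsP; exists ord_max.
  by rewrite mem_pblock cov /=.
rewrite big1 ?addn0 // => B /andP[/andP[BP /existsP[i /andP[iB /eqP ik]]] /eqP[]].
rewrite -(def_pblock tP BP iB); congr pblock.
exact: val_inj.
Qed.

(** The blocks impose independent conditions, whence a product; the last block has one position
    taken by the prescribed letter [z]. *)
Lemma echrom1_sizes k (P : {set {set 'I_k.+1}}) : setpart P ->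
  exists2 r : seq nat,
    perm_eq [seq #|B| | B : {set 'I_k.+1} <- enum P] (lastsize P :: r) &
    forall x z, echrom1 P x z =
      (\prod_(j <- r) inje x j [set: C]) * rooted x (lastsize P).-1 z.
Proof.
move=> pP; have tP := partition_trivIset pP.
have cov i : i \in cover P by rewrite (cover_partition pP) inE.
rewrite lastsizeE //; set B0 := pblock P ord_max.
have B0P : B0 \in P by rewrite pblock_mem.
exists [seq #|B| | B : {set 'I_k.+1} <- enum (P :\ B0)] => [|x z].
  rewrite -map_cons; apply/perm_map/uniq_perm; rewrite /= ?enum_uniq ?andbT //.
    by rewrite mem_enum !inE eqxx.
  by move=> B; rewrite inE !mem_enum !inE; case: eqP => // ->.
(* Each position is labelled by its block. Labels range over all sets, and those outside [P] have
   count [0], hence factor [1]. *)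
pose lab (i : nat) := pblock P (inord i).
have labB0 : lab k = B0.
  by congr pblock; apply: val_inj; rewrite /= inordK.
have labE (i : 'I_k.+1) : lab i = pblock P i by rewrite /lab inord_val.
have cntP B : B \in P -> labcount lab k.+1 B = #|B|.
  move=> BP; rewrite /labcount -sum1_card [RHS]big_mkcond; apply: eq_bigr => i _.
  rewrite labE; case: ifP => iB; first by rewrite (def_pblock tP BP iB) eqxx.
  by case: eqP => // PB; rewrite -PB mem_pblock cov in iB.
have cntN B : B \notin P -> labcount lab k.+1 B = 0.
  move=> BP; rewrite /labcount big1 // => i _; rewrite labE.
  by case: eqP => // PB; rewrite -PB pblock_mem in BP.
rewrite /echrom1 /=.
rewrite (@eq_wsum _ _ _ _ _ (fun w =>
  (blockwise lab (fun=> [set: C]) k.+1 w && (w k == z))%:R * monom x k.+1 w)).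
  rewrite wsum_blockwise_last labB0 mulrC; congr (_ * _).
    rewrite big_map big_enum /= (bigID (mem P)) /= [X in _ * X]big1 ?mulr1.
      apply: eq_big => [B|B /andP[_ BP]]; last by rewrite cntP.
      by rewrite !inE.
    by move=> B /andP[_ BP]; rewrite cntN.
  congr (rooted x _ z); rewrite -(cntP _ B0P) labcountS labB0 eqxx addn1.
  by [].
move=> w; congr ((_ && _)%:R * _); rewrite /blockproper /blockwise.
have -> /= : [forall i : 'I_k.+1, w i \in [set: C]] by apply/forallP => i; rewrite inE.
apply: eq_forallb => i; apply: eq_forallb => j; congr (_ && _ ==> _).
rewrite !labE eq_pblock ?cov //.
apply/existsP/idP => [[B /and3P[BP iB jB]]|ij].
  by rewrite (def_pblock tP BP iB).
by exists (pblock P i); rewrite pblock_mem ?mem_pblock ?cov ?ij.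
Qed.

Lemma setpart_sizes_gt0 k (P : {set {set 'I_k}}) : setpart P ->
  all (leq 1) [seq #|B| | B : {set 'I_k} <- enum P].
Proof.
move=> pP; apply/allP => _ /mapP[B BP ->].
by rewrite mem_enum in BP; rewrite card_gt0 (partition_neq0 pP BP).
Qed.

Lemma setpart_sizes_sum k (P : {set {set 'I_k}}) : setpart P ->
  sumn [seq #|B| | B : {set 'I_k} <- enum P] = k.
Proof.
move=> pP; rewrite sumnE big_map big_enum /= -(card_partition pP).
by rewrite cardsT card_ord.
Qed.

Lemma cone_echrom1 k (P : {set {set 'I_k}}) : (0 < k)%N -> setpart P ->
  cone (@gen1 R C) k (echrom1 P).
Proof.
case: k P => // k P _ pP; have [r pr rE] := echrom1_sizes pP.
have r0 := setpart_sizes_gt0 pP; have rk := setpart_sizes_sum pP.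
rewrite (perm_all _ pr) /= in r0; rewrite (perm_sumn pr) /= in rk.
have [l0 {}r0] := andP r0.
have c1 : cone (@gen1 R C) (lastsize P) (fun x => rooted x (lastsize P).-1).
  by rewrite -{1}(prednK l0); apply/cone_gen/Gen1.
have := cone_prod r0 c1; rewrite {}rk => c2; apply: cone_ext c2 => x z.
by rewrite rE.
Qed.

Lemma echrom1_simpart k (P Q : {set {set 'I_k}}) x z : (0 < k)%N ->
  setpart P -> setpart Q -> simpart P Q -> echrom1 P x z = echrom1 Q x z.
Proof.
case: k P Q => // k P Q _ pP pQ /andP[PQ /eqP lPQ].
have [r pr ->] := echrom1_sizes pP; have [s ps ->] := echrom1_sizes pQ.
rewrite lPQ in pr *; congr (_ * _); apply: perm_big.
by rewrite -(perm_cons (lastsize Q)) -(permPl pr) -(permPr ps).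
Qed.

Lemma perm_enum_setU1 (T : finType) (A : {set T}) a : a \notin A ->
  perm_eq (enum (a |: A)) (a :: enum A).
Proof.
move=> aA; apply: uniq_perm; rewrite /= ?enum_uniq ?mem_enum ?aA // => b.
by rewrite inE !mem_enum !inE.
Qed.

Lemma exists_subset_card (T : finType) (A : {set T}) j : (j <= #|A|)%N ->
  exists2 B : {set T}, B \subset A & #|B| = j.
Proof.
move=> jA; exists [set i in take j (enum A)].
  by apply/subsetP => i; rewrite inE => /mem_take; rewrite mem_enum.
rewrite cardsE; have /card_uniqP -> : uniq (take j (enum A)).
  exact/take_uniq/enum_uniq.
by rewrite size_take -cardE; case: ltngtP jA.
Qed.

Lemma partition_of_sizes (T : finType) (A : {set T}) (r : seq nat) :
  all (leq 1) r -> sumn r = #|A| ->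
  exists2 P : {set {set T}}, partition P A &
    perm_eq [seq #|B| | B : {set T} <- enum P] r.
Proof.
elim: r A => [|j r IHr] A /=.
  move=> _ /esym/eqP; rewrite cards_eq0 => /eqP->.
  by exists set0; rewrite ?partition_set0 // enum_set0.
case/andP=> j0 r0 jr.
have [|B BA Bj] := @exists_subset_card _ A j; first by lia.
have [|P pP rP] := IHr (A :\: B) r0.
  by rewrite cardsD (setIidPr BA) Bj; lia.
have BP : B \notin P.
  apply/negP => /(partitionS pP)/subsetP BAB.
  have /card_gt0P[b bB] : (0 < #|B|)%N by rewrite Bj.
  by have := BAB b bB; rewrite !inE bB.
exists (B |: P); last first.
  by rewrite (permPl (perm_map _ (perm_enum_setU1 BP))) /= Bj perm_cons.
have -> : A = B :|: (A :\: B) by rewrite -{1}(setID A B) (setIidPr BA).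
apply: partitionU1 => //; first by rewrite -card_gt0 Bj.
by rewrite disjoints_subset; apply/subsetP => i; rewrite !inE => ->.
Qed.

Lemma setpart_of_sizes k b r : (0 < b)%N -> all (leq 1) r -> (b + sumn r = k.+1)%N ->
  exists2 P : {set {set 'I_k.+1}}, setpart P &
    perm_eq [seq #|B| | B : {set 'I_k.+1} <- enum P] (b :: r) /\ lastsize P = b.
Proof.
move=> b0 r0 br.
(* These [b.-1] points join [ord_max] to form the last block. *)
have [|B BA Bb] := @exists_subset_card _ [set~ (@ord_max k)] b.-1.
  by rewrite cardsC1 card_ord; lia.
have lB : ord_max \notin B by apply/negP => /(subsetP BA); rewrite !inE eqxx.
set D := ord_max |: B.
have Db : #|D| = b by rewrite cardsU1 lB Bb add1n prednK.
have [|P pP rP] := @partition_of_sizes _ (~: D) r r0.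
  by have := cardsC D; rewrite card_ord Db; lia.
have DP : D \notin P.
  apply/negP => /(partitionS pP)/subsetP/(_ ord_max).
  by rewrite !inE eqxx => /(_ isT).
have pDP : setpart (D |: P).
  rewrite /setpart -(setUCr D); apply: partitionU1 => //.
    by rewrite -card_gt0 Db.
  by rewrite disjoints_subset setCK.
exists (D |: P) => //; split.
  by rewrite (permPl (perm_map _ (perm_enum_setU1 DP))) /= Db perm_cons.
rewrite lastsizeE // -Db; congr #|pred_of_set _|; apply: def_pblock.
- exact: partition_trivIset pDP.
- by rewrite !inE eqxx.
- by rewrite !inE eqxx.
Qed.

Lemma cone_echrom1_exp k f : (0 < k)%N -> cone (@gen1 R C) k f ->
  exists2 d : {set {set 'I_k}} -> R, forall P, 0 <= d P &
    forall x z, f x z = \sum_(P | setpart P) d P * echrom1 P x z.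
Proof.
case: k => // k _ cf.
(* Carrying a list [r] of further factors lets [coneE] push its factor onto [r]; at a generator
   [rooted x t] the sizes [t.+1 :: r] are then realised by a single set partition. *)
suff /(_ _ cf [::] isT (addn0 _))[d d0 fE] : forall K, cone (@gen1 R C) K f ->
    forall r : seq nat, all (leq 1) r -> (K + sumn r = k.+1)%N ->
  exists2 d : {set {set 'I_k.+1}} -> R, forall P, 0 <= d P &
    forall x z, (\prod_(j <- r) inje x j [set: C]) * f x z =
       \sum_(P | setpart P) d P * echrom1 P x z.
  by exists d => // x z; rewrite -fE big_nil mul1r.
move=> {cf} K; elim=> {K f}.
- move=> K r _ _; exists (fun=> 0) => // x z.
  by rewrite mulr0 big1 // => P _; rewrite mul0r.
- move=> K f g _ IHf _ IHg r r0 rK.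
  have [d d0 fE] := IHf r r0 rK; have [d' d0' gE] := IHg r r0 rK.
  exists (fun P => d P + d' P) => [P|x z]; first by rewrite addr_ge0.
  by rewrite mulrDr fE gE -big_split; apply: eq_bigr => P _; rewrite mulrDl.
- move=> K a f a0 _ IHf r r0 rK; have [d d0 fE] := IHf r r0 rK.
  exists (fun P => a * d P) => [P|x z]; first by rewrite mulr_ge0.
  by rewrite mulrCA fE mulr_sumr; apply: eq_bigr => P _; rewrite mulrA.
- move=> K j f j0 _ IHf r r0 rK.
  have [||d d0 fE] := IHf (j :: r); first by rewrite /= j0.
    by rewrite /= addnA.
  by exists d => // x z; rewrite -fE big_cons; ring.
- move=> _ _ [t] r r0 rK.
  have [P pP [rP lP]] := setpart_of_sizes (ltn0Sn t) r0 rK.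
  exists (fun Q => (Q == P)%:R) => [Q|x z]; first exact: ler0n.
  rewrite (bigD1 P) //= eqxx mul1r [X in _ + X]big1 ?addr0; last first.
    by move=> Q /andP[_ /negPf->]; rewrite mul0r.
  have [s sP ->] := echrom1_sizes pP; rewrite lP /=; congr (_ * _).
  apply: perm_big; rewrite -(perm_cons t.+1) -(permPl rP).
  by rewrite (permPl sP) lP.
- move=> K f g fg _ IHf r r0 rK; have [d d0 fE] := IHf r r0 rK.
  by exists d => // x z; rewrite -fg fE.
Qed.

End Partitions.

(** * Every chromatic function has an expansion in the [e_P] *)

Section Spanning.
Local Open Scope ring_scope.
Variable n : nat.

Definition e_span (f : ('I_n -> nat) -> rat) : Prop :=
  exists c : {set {set 'I_n}} -> rat,
    forall w, f w = \sum_(P | setpart P) c P * ecoef P w.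

Lemma e_spanZ a f : e_span f -> e_span (fun w => a * f w).
Proof.
case=> c fE; exists (fun P => a * c P) => w; rewrite fE mulr_sumr.
by apply: eq_bigr => P _; rewrite mulrA.
Qed.

Lemma e_spanD f g : e_span f -> e_span g -> e_span (fun w => f w + g w).
Proof.
case=> c fE [d gE]; exists (fun P => c P + d P) => w; rewrite fE gE -big_split.
by apply: eq_bigr => P _; rewrite mulrDl.
Qed.

Lemma e_span_ext f g : (forall w, f w = g w) -> e_span f -> e_span g.
Proof. by move=> fg [c fE]; exists c => w; rewrite -fg fE. Qed.

Lemma e_span_sum (I : Type) (r : seq I) (P : pred I) (F : I -> ('I_n -> nat) -> rat) :
  (forall i, P i -> e_span (F i)) -> e_span (fun w => \sum_(i <- r | P i) F i w).
Proof.
move=> sF; elim: r => [|i r IHr].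
  by exists (fun=> 0) => w; rewrite big_nil big1 // => Q _; rewrite mul0r.
have [Pi|nPi] := boolP (P i); last first.
  by apply: e_span_ext IHr => w; rewrite big_cons (negPf nPi).
by apply: e_span_ext (e_spanD (sF i Pi) IHr) => w; rewrite big_cons Pi.
Qed.

(** Indicator of the words constant on the cycles of [s], that is, a power sum function in
    non-commuting variables. Indexing by permutations supplies the signs relating it to the
    [e_P]. *)
Definition fixedby (s : 'S_n) (w : 'I_n -> nat) : bool :=
  [forall i, w (s i) == w i].

Lemma fixedby_porbit s w :
  fixedby s w = [forall i, forall j in porbit s i, w j == w i].
Proof.
apply/forallP/forallP => [H i|H i].
  apply/forall_inP => _ /porbitP[k ->].
  elim: k => [|k IHk]; first by rewrite perm1.
  by rewrite expgSr permM (eqP (H _)).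
have /forall_inP := H i; apply.
by rewrite -{1}[s]expg1 mem_porbit.
Qed.

Lemma porbits_setpart (s : 'S_n) : setpart (porbits s).
Proof.
apply/and3P; split.
- rewrite eqEsubset subsetT; apply/subsetP => i _.
  by apply/bigcupP; exists (porbit s i); [exact: imset_f|exact: porbit_id].
- apply/trivIsetP => _ _ /imsetP[i _ ->] /imsetP[j _ ->]; apply: contraR.
  rewrite -setI_eq0 => /set0Pn[k]; rewrite !inE -!eq_porbit_mem => /andP[/eqP<-].
  by [].
- by apply/imsetP => -[i _ /setP/(_ i)]; rewrite inE porbit_id.
Qed.

Lemma porbits_block (s : 'S_n) (i j : 'I_n) :
  [exists B in porbits s, (i \in B) && (j \in B)] = (j \in porbit s i).
Proof.
apply/existsP/idP => [[B /and3P[/imsetP[k _ ->]]]|ij].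
  by rewrite -!eq_porbit_mem => /eqP <- /eqP ->.
by exists (porbit s i); rewrite imset_f ?porbit_id.
Qed.

(* If [w i = w j] inside an orbit of [s], composing with [tperm i j] cancels the
   terms in pairs; otherwise only the identity fixes [w]. *)
Lemma ecoef_porbits (s : 'S_n) w :
  ecoef (porbits s) w =
  \sum_(t : 'S_n | [forall i, t i \in porbit s i]) (-1) ^+ t * (fixedby t w)%:R.
Proof.
rewrite /ecoef; case: ifPn => [/forallP H|].
  rewrite (bigD1 1%g) /=; last by apply/forallP => i; rewrite perm1 porbit_id.
  rewrite odd_perm1 expr0 mul1r.
  have -> : fixedby 1%g w by apply/forallP => i; rewrite perm1.
  rewrite big1 ?addr0 // => t /andP[/forallP ts]; have [/forallP fw|] := boolP (fixedby t w).
    case/eqP; apply/permP => i; rewrite perm1; apply/eqP.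
    have /forallP/(_ (t i))/implyP := H i.
    by rewrite porbits_block ts andbT (eqP (fw i)) eqxx eq_sym => /contraT; case: eqP => // _ /(_ isT).
  by rewrite mulr0.
rewrite negb_forall => /existsP[i]; rewrite negb_forall => /existsP[j].
rewrite negb_imply negbK porbits_block => /andP[/andP[ij sij] /eqP wij].
set S := \sum_(t | _) _.
suff SS : S = - S by lra.
pose u := tperm i j.
have wu k : w (u k) = w k.
  by rewrite /u; case: tpermP => [->|->|].
have su k : porbit s (u k) = porbit s k.
  have sij' : porbit s j = porbit s i by apply/eqP; rewrite eq_porbit_mem.
  by rewrite /u; case: tpermP => [->|->|].
rewrite {1}/S (reindex_inj (mulgI u)) /= -sumrN; apply: eq_big => t.
  apply/forallP/forallP => H k.
    by have := H (u k); rewrite permM tpermK su.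
  by rewrite permM -su.
move=> _; rewrite odd_mul_tperm ij signr_addb expr1 mulN1r mulNr.
congr (- (_ * _%:R)); congr nat_of_bool; apply/forallP/forallP => H k.
  by have := H (u k); rewrite permM tpermK wu.
by rewrite permM -(wu k).
Qed.

(** [ecoef_porbits] is triangular: the permutations with the same orbits as [s] contribute equal
    terms, and all others have strictly finer orbits. The induction is on the number of pairs
    sharing an orbit. *)
Lemma fixedby_span s : e_span (fun w => (fixedby s w)%:R).
Proof.
pose rel_of (t : 'S_n) := [set p : 'I_n * 'I_n | p.2 \in porbit t p.1].
have [m] := ubnP #|rel_of s|; elim: m s => // m IHm s; rewrite ltnS => sm.
pose D (t : 'S_n) := [forall i, t i \in porbit s i].
have D_rel t : D t -> rel_of t \subset rel_of s.
  move=> /forallP Dt; apply/subsetP => -[i j]; rewrite !inE /= => /porbitP[k ->].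
  elim: k => [|k IHk]; first by rewrite perm1 porbit_id.
  rewrite expgSr permM; have := Dt ((t ^+ k)%g i).
  by rewrite -!eq_porbit_mem in IHk * => /eqP->.
have porb t : rel_of t = rel_of s -> porbit t =1 porbit s.
  move=> ts i; apply/setP => j; have /setP/(_ (i, j)) := ts.
  by rewrite !inE.
pose N := #|[pred t | D t && (rel_of t == rel_of s)]|.
have N0 : (N%:R : rat) != 0.
  rewrite pnatr_eq0 -lt0n; apply/card_gt0P; exists s; rewrite inE eqxx andbT.
  by apply/forallP => i; rewrite -{1}[s]expg1 mem_porbit.
have sN w : ecoef (porbits s) w = N%:R * (-1) ^+ s * (fixedby s w)%:R +
   \sum_(t | D t && (rel_of t != rel_of s)) (-1) ^+ t * (fixedby t w)%:R.
  rewrite ecoef_porbits (bigID (fun t => rel_of t == rel_of s)) /=; congr (_ + _).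
  rewrite (eq_bigr (fun=> (-1) ^+ s * (fixedby s w)%:R)).
    by rewrite sumr_const -[LHS]mulr_natl mulrA.
  (* The sign of a permutation depends only on its number of orbits. *)
  move=> t /andP[_ /eqP/porb ts].
  have pts : porbits t = porbits s by apply: eq_imset.
  rewrite /odd_perm /= pts !fixedby_porbit.
  by congr (_ * _%:R); congr nat_of_bool; apply: eq_forallb => i; rewrite ts.
have e_s : e_span (ecoef (porbits s)).
  exists (fun P => (P == porbits s)%:R) => w.
  rewrite (bigD1 (porbits s)) ?porbits_setpart //= eqxx mul1r big1 ?addr0 //.
  by move=> P /andP[_ /negPf->]; rewrite mul0r.
have e_t : e_span (fun w => \sum_(t | D t && (rel_of t != rel_of s))
                      (-1) ^+ t * (fixedby t w)%:R).
  apply: e_span_sum => t /andP[Dt ts]; apply: e_spanZ; apply: IHm.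
  by apply: leq_trans sm; apply: proper_card; rewrite properEneq ts D_rel.
apply: e_span_ext (e_spanZ (N%:R^-1 * (-1) ^+ s) (e_spanD e_s (e_spanZ (-1) e_t))) => w.
rewrite sN mulN1r addrK.
by rewrite mulrA mulrACA mulVf // -signr_addb addbb expr0 !mul1r.
Qed.

(* When [i] and [j] lie in distinct cycles of [s], [tperm i j * s] merges them. *)
Lemma fixedby_merge s (i j : 'I_n) :
  exists t, forall w, fixedby t w = fixedby s w && (w i == w j).
Proof.
have [ij|nij] := boolP (i \in porbit s j).
  exists s => w; case: (boolP (fixedby s w)) => //=.
  rewrite fixedby_porbit => /forallP/(_ j)/forall_inP/(_ i ij).
  by [].
have i_j : i != j by apply: contraNneq nij => ->; apply: porbit_id.
pose u := tperm i j; exists (u * s)%g => w.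
have uw (v : 'I_n -> nat) : v i = v j -> forall k, v (u k) = v k.
  by move=> vij k; rewrite /u; case: tpermP => [->|->|].
have ij : i \in porbit (u * s) j.
  (* If [i] and [j] were separated in [u * s] as well, multiplying by [u] twice would lower the
     number of orbits by two, yet it gives back [s]. *)
  have := porbits_mul_tperm s i j; have := porbits_mul_tperm (u * s)%g i j.
  rewrite /= -/u mulgA tperm2 mul1g nij i_j.
  case: (i \in _) => // H1 H2; exfalso; move: H1 H2.
  by rewrite [(~~ false).*2]/= [true.*2]/= !addn1 !addn2; move: #|porbits s| #|porbits (u * s)|; lia.
apply/idP/andP => [H|[/forallP H /eqP wij]].
  have wij : w i = w j.
    move: (H); rewrite fixedby_porbit => /forallP/(_ j)/forall_inP/(_ i ij).
    by move/eqP.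
  split; last exact/eqP.
  apply/forallP => k; have /forallP/(_ (u k)) := H.
  by rewrite permM tpermK uw.
by apply/forallP => k; rewrite permM (eqP (H _)) uw.
Qed.

(** Deletion and contraction, edge by edge: the indicator of [w i != w j] is [1] minus that of
    [w i == w j], and [fixedby_merge] absorbs the latter into the permutation. *)
Lemma e_expansion_exists (g : rel 'I_n) : exists c, is_e_expansion g c.
Proof.
suff H (l : seq ('I_n * 'I_n)) s :
    e_span (fun w => (fixedby s w && all (fun p => w p.1 != w p.2) l)%:R).
  have [c cE] := H [seq p <- enum {: 'I_n * 'I_n} | g p.1 p.2] 1%g.
  exists c => w; rewrite -cE /Ycoef.
  have -> : fixedby 1%g w by apply/forallP => i; rewrite perm1.
  have -> : [forall i, forall j, g i j ==> (w i != w j)] =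
     all (fun p => w p.1 != w p.2) [seq p <- enum {: 'I_n * 'I_n} | g p.1 p.2].
    apply/forallP/allP => [G [i j]|G i].
      by rewrite mem_filter => /andP[/= gij _]; have /forallP/(_ j)/implyP := G i; apply.
    apply/forallP => j; apply/implyP => gij.
    by apply: (G (i, j)); rewrite mem_filter gij mem_enum.
  by case: ifP.
elim: l s => [|[i j] l IHl] s.
  by apply: e_span_ext (fixedby_span s) => w; rewrite andbT.
have [t tE] := fixedby_merge s i j.
apply: e_span_ext (e_spanD (IHl s) (e_spanZ (-1) (IHl t))) => w /=.
rewrite tE; case: (fixedby s w); case: (w i == w j); case: (all _ l) => /=; ring.
Qed.

End Spanning.

(** * From pointed functions back to words *)

Section Symmetrization.
Local Open Scope ring_scope.

Lemma digits_inj B N (u v : nat -> nat) :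
  (forall c, (c < N)%N -> (u c < B)%N) -> (forall c, (c < N)%N -> (v c < B)%N) ->
  (\sum_(c < N) u c * B ^ c = \sum_(c < N) v c * B ^ c)%N ->
  forall c, (c < N)%N -> u c = v c.
Proof.
elim: N u v => [|N IHN] u v uB vB //; rewrite !big_ord_recl /= !expn0 !muln1.
have shift f : (\sum_(i < N) f (bump 0 i) * B ^ bump 0 i =
    (\sum_(i < N) f i.+1 * B ^ i) * B)%N.
  by rewrite big_distrl /=; apply: eq_bigr => i _; rewrite expnSr mulnA.
rewrite !shift => E.
have u0 := uB 0%N isT; have v0 := vB 0%N isT.
have E0 : u 0%N = v 0%N.
  by have := congr1 (modn^~ B) E; rewrite /= ![(_ 0%N + _)%N]addnC !modnMDl !modn_small.
move: E; rewrite E0 => /addnI/eqP; rewrite eqn_pmul2r; last by lia.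
move/eqP=> E [|c] cN //; apply: (IHN (u \o succn) (v \o succn)) => // i iN.
  exact: uB.
exact: vB.
Qed.

Variables (k N : nat).
Implicit Types (w : {ffun 'I_k -> 'I_N}) (s : 'S_k).

(* The exponent of [X] in the monomial of [w] once [x c] is [X^((k+1)^c)]: it
   determines the number of occurrences of each letter. *)
Definition kronecker w : nat := (\sum_i k.+1 ^ w i)%N.

Definition permword w s : {ffun 'I_k -> 'I_N} := [ffun i => w (s i)].

Lemma permwordM w s t : permword (permword w s) t = permword w (t * s)%g.
Proof. by apply/ffunP => i; rewrite !ffunE permM. Qed.

Lemma permword1 w : permword w 1%g = w.
Proof. by apply/ffunP => i; rewrite ffunE perm1. Qed.

Lemma kronecker_perm w s : kronecker (permword w s) = kronecker w.
Proof.
rewrite /kronecker [RHS](reindex_inj (@perm_inj _ s)).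
by apply: eq_bigr => i _; rewrite ffunE.
Qed.

Lemma kronecker_eq w v : kronecker w = kronecker v -> exists s, w = permword v s.
Proof.
pose cnt (u : {ffun 'I_k -> 'I_N}) (c : nat) := #|[set i | val (u i) == c]|.
have cntE u : kronecker u = (\sum_(c < N) cnt u c * k.+1 ^ c)%N.
  rewrite /kronecker (partition_big u predT) //=; apply: eq_bigr => c _.
  rewrite (eq_bigr (fun=> k.+1 ^ c)%N) => [|i /eqP-> //].
  by rewrite sum_nat_const; congr (_ * _)%N; apply: eq_card => i; rewrite !inE.
have cntB u c : (cnt u c < k.+1)%N.
  by rewrite ltnS; apply: leq_trans (max_card _) _; rewrite card_ord.
rewrite !cntE => /digits_inj E.
have {}E (c : 'I_N) : cnt w c = cnt v c by apply: E.
have : perm_eq [tuple w i | i < k] [tuple v i | i < k].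
  apply/allP => c _ /=; apply/eqP.
  have cE (u : {ffun 'I_k -> 'I_N}) : count_mem c [tuple u i | i < k] = cnt u c.
    rewrite /= count_map -size_filter /cnt cardE /enum_mem -enumT /=.
    rewrite -filter_predI; congr size; apply: eq_filter => i.
    by rewrite /= !inE /= -val_eqE ?andbT.
  by rewrite !cE.
case/tuple_permP => s ws; exists s; apply/ffunP => i; rewrite ffunE.
have := congr1 (fun t => nth (w i) t i) ws.
by rewrite -!tnth_nth !tnth_mktuple.
Qed.

(** Putting [x c = t ^ (k.+1 ^ c)] turns the hypothesis into a polynomial in [t] vanishing at every
    rational, so all its coefficients are zero. *)
Lemma coef_extraction (Q : pred {ffun 'I_k -> 'I_N}) (f : {ffun 'I_k -> 'I_N} -> rat) :
  (forall x : 'I_N -> rat, \sum_(w | Q w) f w * \prod_i x (w i) = 0) ->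
  forall m, \sum_(w | Q w && (kronecker w == m)) f w = 0.
Proof.
move=> H m; pose p : {poly rat} := \sum_(w | Q w) f w *: 'X^(kronecker w).
have p_root t : p.[t] = 0.
  rewrite /p horner_sum -[RHS](H (fun c => t ^+ (k.+1 ^ c))).
  apply: eq_bigr => w _; rewrite hornerZ hornerXn; congr (_ * _).
  by rewrite /kronecker expr_sum.
have p0 : p = 0.
  apply/eqP/negPn/negP => p0.
  pose rs : seq rat := [seq i%:R | i <- iota 0 (size p)].
  suff : (size rs < size p)%N by rewrite size_map size_iota ltnn.
  apply: max_poly_roots => //; first by apply/allP => t _; apply/rootP.
  by rewrite map_inj_uniq ?iota_uniq // => i j /eqP; rewrite eqr_nat => /eqP.
have pm : p`_m = 0 by rewrite p0 coef0.
rewrite -[RHS]pm /p coef_sum big_mkcondr; apply: eq_bigr => w _.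
by rewrite coefZ coefXn eq_sym; case: eqP; rewrite ?mulr1 ?mulr0.
Qed.

(** The words with the content of [w] and its letter at [l] form one orbit under the stabiliser of
    [l]. The symmetrized coefficient is constant on this orbit, and its sum there vanishes by
    [coef_extraction]. *)
Lemma symmetrized_eq0 (l : 'I_k) (f : {ffun 'I_k -> 'I_N} -> rat) :
  (forall (x : 'I_N -> rat) z, \sum_(w : {ffun 'I_k -> 'I_N} | w l == z) f w * \prod_i x (w i) = 0) ->
  forall w, \sum_(s : 'S_k | s l == l) f (permword w s) = 0.
Proof.
move=> H w0; have H0 := coef_extraction (H^~ (w0 l)) (kronecker w0).
set A := fun w : {ffun 'I_k -> 'I_N} =>
  (w l == w0 l) && (kronecker w == kronecker w0) in H0.
have Aw0 : A w0 by rewrite /A !eqxx.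
have Aperm s w : s l == l -> A (permword w s) = A w.
  by move=> /eqP sl; rewrite /A ffunE sl kronecker_perm.
have : \sum_(w | A w) \sum_(s : 'S_k | s l == l) f (permword w s) = 0.
  rewrite exchange_big big1 // => s sl.
  rewrite -[RHS]H0 [RHS](reindex (permword^~ s)) /=.
    by apply: eq_bigl => w; rewrite -/(A _) Aperm.
  exists (permword^~ s^-1%g) => w _; rewrite permwordM ?mulVg ?mulgV permword1 //.
rewrite (eq_bigr (fun=> \sum_(s : 'S_k | s l == l) f (permword w0 s))).
  rewrite sumr_const => /eqP; rewrite mulrn_eq0 => /orP[/eqP|/eqP//].
  move/card0_eq => A0; have : A w0 = false by apply: (A0 w0).
  by rewrite Aw0.
move=> w /andP[/eqP wl /eqP/kronecker_eq[s ws]].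
(* The rearranging permutation need not fix [l]; as [w0] takes equal values at [s l] and [l], a
   transposition repairs this. *)
have [t tl wt] : exists2 t : 'S_k, t l == l & w = permword w0 t.
  exists (s * tperm (s l) l)%g; first by rewrite permM tpermL.
  apply/ffunP => i; rewrite ws !ffunE permM.
  have sl : w0 (s l) = w0 l by rewrite -wl ws ffunE.
  by case: tpermP => [->|->|].
rewrite [RHS](reindex_inj (mulIg t)) /=; apply: eq_big => s'.
  rewrite permM; apply/eqP/eqP => [->|]; first exact/eqP.
  by move=> h; apply: (@perm_inj _ t); rewrite h (eqP tl).
by rewrite wt permwordM.
Qed.

End Symmetrization.

(** * The action of permutations of positions on set partitions *)

Section PermutedPartitions.
Local Open Scope ring_scope.
Variable k : nat.
Implicit Types (P Q : {set {set 'I_k}}) (s : 'S_k).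

Definition permpart s P : {set {set 'I_k}} := [set s @: B | B : {set 'I_k} in P].

Lemma permpartK s : cancel (permpart s) (permpart s^-1%g).
Proof.
move=> P; rewrite /permpart -imset_comp -[RHS]imset_id; apply: eq_imset => B /=.
by rewrite -imset_comp -[RHS]imset_id; apply: eq_imset => i /=; rewrite permK.
Qed.

Lemma permpart_inj s : injective (permpart s).
Proof. exact: can_inj (permpartK s). Qed.

Lemma setpart_permpart s P : setpart (permpart s P) = setpart P.
Proof.
have sT : s @: [set: 'I_k] = [set: 'I_k].
  by apply/setP => i; rewrite inE -[i](permKV s) imset_f.
by rewrite /setpart -{1}sT imset_partition //; apply: perm_inj.
Qed.

Lemma ecoef_permpart s P (w : 'I_k -> nat) : ecoef P (w \o s) = ecoef (permpart s P) w.
Proof.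
rewrite /ecoef; congr (if _ then _ else _).
have blockE i j : [exists B in permpart s P, (s i \in B) && (s j \in B)] =
    [exists B in P, (i \in B) && (j \in B)].
  apply/existsP/existsP => -[B /andP[BP ijB]].
    case/imsetP: BP ijB => D DP -> ; rewrite !mem_imset; try exact: perm_inj.
    by move=> ijD; exists D; rewrite DP.
  by exists (s @: B); rewrite imset_f //= !mem_imset //; exact: perm_inj.
apply/forallP/forallP => H i; apply/forallP => j; apply/implyP => ij.
  have /forallP/(_ (s^-1 j)%g)/implyP := H (s^-1 i)%g; rewrite /= !permKV; apply.
  by rewrite (inj_eq perm_inj) -blockE !permKV.
have /forallP/(_ (s j))/implyP := H (s i); apply.
by rewrite (inj_eq perm_inj) blockE.
Qed.

(** A permutation preserves block sizes, and one fixing the last point sends the last block to the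
    last block. *)
Lemma simpart_permpart s P Q (l : 'I_k) : val l = k.-1 -> s l = l ->
  simpart P (permpart s Q) = simpart P Q.
Proof.
move=> lk sl; have sinj : injective (fun B : {set 'I_k} => s @: B).
  exact/imset_inj/perm_inj.
have sz : perm_eq [seq #|B| | B : {set 'I_k} <- enum (permpart s Q)]
                  [seq #|B| | B : {set 'I_k} <- enum Q].
  have e : perm_eq (enum (permpart s Q)) [seq s @: B | B : {set 'I_k} <- enum Q].
    apply: uniq_perm; rewrite ?enum_uniq ?map_inj_uniq ?enum_uniq // => B.
    rewrite mem_enum; apply/imsetP/mapP => -[D DQ ->]; exists D => //.
      by rewrite mem_enum.
    by rewrite mem_enum in DQ.
  rewrite (permPl (perm_map _ e)) -map_comp; apply/seq.permP => a.
  congr count; apply: eq_map => B /=.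
  by rewrite card_imset //; apply: perm_inj.
have ls : lastsize (permpart s Q) = lastsize Q.
  rewrite /lastsize big_mkcondr /permpart big_imset /=; last exact: (in2W sinj).
  rewrite [RHS]big_mkcondr; apply: eq_bigr => B _.
  rewrite card_imset; last exact: perm_inj.
  congr (if _ then _ else _); apply/existsP/existsP => -[i /andP[iB /eqP ik]].
    have il : i = l by apply: val_inj; rewrite /= -lk in ik *.
    exists l; rewrite lk eqxx andbT.
    by move: iB; rewrite il -{1}sl mem_imset //; apply: perm_inj.
  have il : i = l by apply: val_inj; rewrite /= -lk in ik *.
  exists l; rewrite lk eqxx andbT -sl mem_imset; last exact: perm_inj.
  by rewrite -il.
by rewrite /simpart ls (permPr sz).
Qed.

End PermutedPartitions.

(** * Class sums, finite alphabets, and passing between expansions and pointed functions *)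

Section Glue.
Local Open Scope ring_scope.

Lemma simpart_sym k (P Q : {set {set 'I_k}}) : simpart P Q = simpart Q P.
Proof. by rewrite /simpart perm_sym eq_sym. Qed.

Lemma simpart_trans k (P Q S : {set {set 'I_k}}) :
  simpart P Q -> simpart Q S -> simpart P S.
Proof.
by move=> /andP[PQ /eqP lPQ] /andP[QS /eqP lQS]; rewrite /simpart (perm_trans PQ QS) lPQ lQS eqxx.
Qed.

(** Pairing with a function constant on the classes sees only the class sums. Dividing by the class
    size [sz] avoids choosing representatives. *)
Lemma equiv_n_sum k (c d : {set {set 'I_k}} -> rat) (v : {set {set 'I_k}} -> rat) :
  equiv_n c d ->
  (forall P Q, setpart P -> setpart Q -> simpart P Q -> v P = v Q) ->
  \sum_(P | setpart P) c P * v P = \sum_(P | setpart P) d P * v P.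
Proof.
move=> cd vE.
pose sz (Q : {set {set 'I_k}}) : rat :=
  \sum_(P | setpart P && simpart P Q) 1.
have sz0 Q : setpart Q -> sz Q != 0.
  move=> pQ; rewrite /sz sumr_const pnatr_eq0 -lt0n; apply/card_gt0P; exists Q.
  by rewrite unfold_in pQ /simpart perm_refl eqxx.
suff avg (a : {set {set 'I_k}} -> rat) : \sum_(P | setpart P) a P * v P =
    \sum_(P | setpart P) v P / sz P * \sum_(Q | setpart Q && simpart P Q) a Q.
  by rewrite !avg; apply: eq_bigr => P pP; rewrite cd.
under [RHS]eq_bigr do rewrite mulr_sumr.
rewrite (exchange_big_dep (fun Q => setpart Q)) /=; last by move=> P Q _ /andP[].
apply: eq_bigr => Q pQ.
rewrite (eq_bigr (fun=> (a Q * v Q / sz Q) * 1)) => [|P /andP[pP /andP[_ PQ]]].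
  rewrite -mulr_sumr (eq_bigl (fun P => setpart P && simpart P Q)).
    by rewrite -/(sz Q) mulfVK // sz0.
  by move=> P; rewrite pQ.
rewrite (vE _ _ pP pQ PQ); have -> : sz P = sz Q.
  apply: eq_bigl => S; congr (_ && _); apply/idP/idP => h.
    exact: simpart_trans h PQ.
  by apply: simpart_trans h _; rewrite simpart_sym.
by rewrite mulr1 mulrC mulrA.
Qed.

(** [ecoef] depends only on which letters agree, so [k] letters suffice to test an identity; each
    letter becomes the index of its first occurrence. *)
Lemma eq_kernel_word k (w : 'I_k -> nat) :
  exists v : {ffun 'I_k -> 'I_k}, forall i j, (w i == w j) = (v i == v j).
Proof.
case: k w => [|k] w; first by exists [ffun i => i] => -[].
pose s := [seq w i | i <- enum 'I_k.+1].
have ws i : w i \in s by rewrite map_f // mem_enum.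
have si i : (index (w i) s < k.+1)%N.
  by rewrite -[X in (_ < X)%N](size_enum_ord k.+1) -(size_map w) index_mem.
exists [ffun i => inord (index (w i) s)] => i j; rewrite !ffunE.
apply/eqP/eqP => [->//|/(congr1 val)]; rewrite /= !inordK // => h.
by rewrite -(nth_index 0%N (ws i)) h nth_index.
Qed.

Lemma eq_kernel_ecoef k (P : {set {set 'I_k}}) (w v : 'I_k -> nat) :
  (forall i j, (w i == w j) = (v i == v j)) -> ecoef P w = ecoef P v.
Proof.
move=> wv; rewrite /ecoef; congr (if _ then _ else _).
by apply: eq_forallb => i; apply: eq_forallb => j; rewrite wv.
Qed.

Lemma ecoef_blockproper k N (P : {set {set 'I_k}}) (w : nat -> 'I_N) :
  ecoef P (fun i => val (w (val i))) = (blockproper P w)%:R.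
Proof. by rewrite /ecoef /blockproper; case: ifP. Qed.

Lemma Ycoef_proper_word k N (g : rel 'I_k) (E : rel nat) (w : nat -> 'I_N) :
  (forall i j : 'I_k, E i j = g i j) ->
  Ycoef g (fun i => val (w (val i))) = (proper_word E k w)%:R.
Proof.
move=> Eg; rewrite /Ycoef /proper_word.
have -> : [forall i : 'I_k, forall j : 'I_k, E i j ==> (w i != w j)] =
          [forall i : 'I_k, forall j : 'I_k, g i j ==> (w i != w j)].
  by apply: eq_forallb => i; apply: eq_forallb => j; rewrite Eg.
by case: ifP.
Qed.

Lemma chrom1_expansion k N (c0 : 'I_N) (g : rel 'I_k) (E : rel nat) c :
  (forall i j : 'I_k, E i j = g i j) -> is_e_expansion g c ->
  forall (x : 'I_N -> rat) z,
  chrom1 c0 E k x z = \sum_(P | setpart P) c P * echrom1 c0 P x z.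
Proof.
move=> Eg cE x z.
rewrite (eq_bigr (fun P => wsum c0 k (fun w => c P *
   ((blockproper P w && (w k.-1 == z))%:R * monom x k w)))) => [|P _]; last first.
  by rewrite wsumZ.
rewrite -wsum_sum; apply: eq_wsum => w.
rewrite -mulnb natrM -(Ycoef_proper_word _ Eg) cE -mulrA mulr_suml.
apply: eq_bigr => P _.
by rewrite ecoef_blockproper -mulnb natrM !mulrA.
Qed.

Lemma ord_relE n (e : rel 'I_n) (i j : 'I_n) : ord_rel e i j = e i j.
Proof. by rewrite /ord_rel !valK. Qed.

Lemma ord_rel_out n (e : rel 'I_n) i j : (n <= i)%N || (n <= j)%N -> ord_rel e i j = false.
Proof.
move=> ij; rewrite /ord_rel; case: insubP => // a ia _; case: insubP => // b jb _.
by case/orP: ij; rewrite leqNgt ?ia ?jb.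
Qed.

Lemma ord_rel_TL m i j : ord_rel (@TL m) i j =
  [&& (i < m)%N, (j < m)%N, i != j, (i <= j + 2)%N & (j <= i + 2)%N].
Proof.
have [im|mi] := ltnP i m; last by rewrite ord_rel_out ?mi.
have [jm|mj] := ltnP j m; last by rewrite ord_rel_out ?mj ?orbT.
by rewrite (ord_relE (@TL m) (Ordinal im) (Ordinal jm)).
Qed.

Lemma ord_rel_concat n m (g : rel 'I_n) (h : rel 'I_m) i j :
  (i < n + m - 1)%N -> (j < n + m - 1)%N ->
  ord_rel (concat g h) i j = ord_rel g i j ||
    [&& (n.-1 <= i)%N, (n.-1 <= j)%N & ord_rel h (i - n.-1)%N (j - n.-1)%N].
Proof. by move=> iK jK; rewrite (ord_relE (concat g h) (Ordinal iK) (Ordinal jK)). Qed.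

(* Once the pointed function of [g] is [\sum_P d P * echrom1 P] with [d >= 0],
   any expansion [c] of [g] differs from [d] by a combination of the [e_P] that
   vanishes after averaging over the permutations fixing the last vertex, so
   subtracting this average from [c] yields the required expansion. *)
Lemma semi_sym_e_positive_of_pointed k (c0 : 'I_k) (g : rel 'I_k) (E : rel nat)
    (d : {set {set 'I_k}} -> rat) :
  (forall i j : 'I_k, E i j = g i j) -> (forall P, 0 <= d P) ->
  (forall (x : 'I_k -> rat) z,
     chrom1 c0 E k x z = \sum_(P | setpart P) d P * echrom1 c0 P x z) ->
  semi_sym_e_positive g.
Proof.
move=> Eg d0 dE; have [c cE] := e_expansion_exists g.
have k0 : (0 < k)%N by apply: leq_ltn_trans (ltn_ord c0).
have lk : (k.-1 < k)%N by rewrite prednK.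
pose l := Ordinal lk; pose a P := c P - d P.
pose f (w : {ffun 'I_k -> 'I_k}) :=
  \sum_(P | setpart P) a P * ecoef P (fun i => val (w i)).
(* [c] and [d] give the same pointed function, so their difference gives zero. *)
have fH (x : 'I_k -> rat) z :
    \sum_(w : {ffun 'I_k -> 'I_k} | w l == z) f w * \prod_i x (w i) = 0.
  pose h (w : nat -> 'I_k) := \sum_(P | setpart P)
    a P * ((blockproper P w && (w k.-1 == z))%:R * monom x k w).
  have hs : wsum c0 k h = 0.
    rewrite wsum_sum (eq_bigr (fun P => c P * echrom1 c0 P x z - d P * echrom1 c0 P x z)).
      by rewrite sumrB -dE (chrom1_expansion c0 Eg cE) subrr.
    by move=> P _; rewrite wsumZ -mulrBl.
  rewrite wsum_ffun in hs; last first.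
    move=> u v uv; apply: eq_bigr => P _; congr (_ * ((_ && _)%:R * _)).
    - by apply: eq_forallb => i; apply: eq_forallb => j; rewrite !uv.
    - by rewrite uv.
    - by apply: eq_bigr => i _; rewrite uv.
  rewrite -[RHS]hs big_mkcond; apply: eq_bigr => w _; rewrite /h /f.
  have wl : word c0 w k.-1 = w l by exact: (wordE c0 w l).
  case: (w l =P z) => wz; last first.
    by rewrite big1 // => P _; rewrite wl (introF eqP wz) andbF mul0r mulr0.
  rewrite mulr_suml; apply: eq_bigr => P _; rewrite wl wz eqxx andbT mulrA.
  rewrite -ecoef_blockproper; congr (_ * _ * _).
    by apply: eq_kernel_ecoef => i j; rewrite !wordE.
  by apply: eq_bigr => i _; rewrite wordE.
pose S := [pred s : 'S_k | s l == l].
pose avg P := #|S|%:R^-1 * \sum_(s in S) a (permpart s^-1%g P).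
have S0 : #|S|%:R != 0 :> rat.
  by rewrite pnatr_eq0 -lt0n; apply/card_gt0P; exists 1%g; rewrite inE perm1.
(* Moving [s] from the partition to the word turns the average into a sum of [f] over permuted
   words, which [symmetrized_eq0] kills. *)
have avg0 (w : 'I_k -> nat) : \sum_(P | setpart P) avg P * ecoef P w = 0.
  have [v wv] := eq_kernel_word w.
  under eq_bigr do rewrite /avg -mulrA mulr_suml.
  rewrite -mulr_sumr exchange_big /= -[RHS](mulr0 #|S|%:R^-1); congr (_ * _).
  rewrite -[RHS](symmetrized_eq0 fH v); apply: eq_bigr => s _.
  rewrite /f (reindex_inj (@permpart_inj _ s)) /=.
  apply: eq_big => [P|P _]; first by rewrite setpart_permpart.
  rewrite permpartK -ecoef_permpart; congr (_ * _).
  by apply: eq_kernel_ecoef => i j; rewrite /= !ffunE wv.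
exists (fun P => c P - avg P), d; split=> //.
  move=> w; under eq_bigr do rewrite mulrBl.
  by rewrite sumrB avg0 subr0.
(* The permutations in [S] preserve every class, so [avg] and [a = c - d] have equal class sums;
   hence so do [c - avg] and [d]. *)
move=> P pP; apply/eqP; rewrite -subr_eq0 -sumrB.
rewrite (eq_bigr (fun Q => a Q - avg Q)) => [|Q _]; last by rewrite /a; ring.
rewrite sumrB subr_eq0; apply/eqP; rewrite /avg -mulr_sumr exchange_big /=.
rewrite [X in _ * X](eq_bigr (fun=> \sum_(Q | setpart Q && simpart P Q) a Q)).
  by rewrite sumr_const -[X in _ * X]mulr_natl mulrA mulVf ?mul1r.
move=> s /eqP sl.
rewrite (reindex_inj (@permpart_inj _ s)) /=.
apply: eq_big => [Q|Q _]; last by rewrite permpartK.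
by rewrite setpart_permpart (simpart_permpart _ _ (erefl : val l = k.-1) sl).
Qed.

End Glue.

Theorem mainTheorem13 (n m : nat) (g : rel 'I_n) :
  (0 < n)%N -> (0 < m)%N -> irreflexive g -> symmetric g ->
  semi_sym_e_positive g ->
  semi_sym_e_positive (concat g (@TL m)).
Proof.
move=> n0 m0 _ _ [c [d [cE d0 cd]]].
set K := (n + m - 1)%N; have K0 : (0 < K)%N by rewrite /K; lia.
have nK : (n <= K)%N by rewrite /K; lia.
(* The alphabet ['I_K], with as many letters as the final graph has vertices, is used for [g] as
   well. *)
pose c0 := Ordinal K0; pose E := ord_rel (concat g (@TL m)).
have EE i j : (i < K)%N -> (j < K)%N -> E i j = ord_rel g i j ||
    [&& (n.-1 <= i)%N, (n.-1 <= j)%N & ord_rel (@TL m) (i - n.-1)%N (j - n.-1)%N].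
  exact: ord_rel_concat.
(* The ladder adds no edge among the first [n] vertices, since it meets them only in vertex
   [n.-1]. *)
have Eg (i j : 'I_n) : E i j = g i j.
  rewrite EE ?(leq_trans (ltn_ord _)) // ord_relE ord_rel_TL.
  have := ltn_ord i; have := ltn_ord j; case: (g i j) => //= *; lia.
(* The pointed functions [echrom1] are constant on classes, so the coefficients [c] may be traded
   for the nonnegative [d]. *)
have cone_n : cone (@gen1 rat 'I_K) n (chrom1 c0 E n).
  have := @cone_sum rat _ _ (@gen1 rat 'I_K) n _ (index_enum _) (@setpart n)
    (fun P x z => d P * echrom1 c0 P x z)%R.
  move=> H; apply: cone_ext (H _) => [x z|P pP].
    rewrite (chrom1_expansion c0 Eg cE); apply/esym/equiv_n_sum => // P Q.
    exact: echrom1_simpart.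
  by apply: coneZ (d0 P pP) _; apply: cone_echrom1.
have cone_K : cone (@gen1 rat 'I_K) K (chrom1 c0 E K).
  apply: cone_chrom1_ladder cone_n; first by rewrite n0.
    move=> j /andP[nj jK]; rewrite EE // (ord_rel_out g) ?nj // ord_rel_TL; lia.
  move=> i j /andP[nj jK] ij; have iK := ltn_trans ij jK.
  rewrite !EE // !(ord_rel_out g) ?nj ?orbT // !ord_rel_TL /=.
  by move: jK; rewrite /K; lia.
have [d' d'0 dE] := cone_echrom1_exp c0 K0 cone_K.
apply: (semi_sym_e_positive_of_pointed (c0 := c0) (E := E) (d := d')) => // i j.
exact: ord_relE.
Qed.
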